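(* Let $N\ge1$, $k\ge0$ be integers, $\delta>0$ and $p\in[1,+\infty]$. There exists $C$ depending only on $N$, $\delta$, $k$ and $p$ such that the following holds. Let $U$ be a (bounded) measurable subset of $\mathbb R^N$ with inradius $r_U$ and diameter $h_U$ such that $\frac{r_U}{h_U}\ge\delta>0$. Then $$\|\pi_U^kg\|_{L^p(U)}\le C\|g\|_{L^p(U)}\qquad\text{for all }g\in L^p(U).$$
   Context: $\mathbb P^k(U)$ is the space of (restrictions to $U$ of) polynomials in $N$ variables of total degree $\le k$. The $L^2$-projector $\pi_U^k:L^1(U)\to\mathbb P^k(U)$ maps $w\in L^1(U)$ to the unique $\pi_U^kw\in\mathbb P^k(U)$ such that $\int_U(\pi_U^kw)v=\int_Uwv$ for all $v\in\mathbb P^k(U)$. The inradius $r_U$ is the radius of the largest ball contained in $U$. *)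

(* Defs.v *)
From HB Require Import structures.
From mathcomp Require Import all_boot all_order all_algebra.
From mathcomp Require Import all_classical all_reals all_analysis.
(* The notations of mpoly clash with those of mathcomp-analysis. *)
From mathcomp Require mpoly.
Import (canonicals, coercions) mpoly.
Set Implicit Arguments.
Unset Strict Implicit.
Unset Printing Implicit Defensive.
Import Order.TTheory GRing.Theory Num.Theory.
Import numFieldNormedType.Exports.
Local Open Scope classical_set_scope.
Local Open Scope ring_scope.

Section borel_lebesgue.
Context {R : realType}.
Local Notation RT := (measurableTypeR R).

Definition tuple_cons n (z : RT * n.-tuple RT) : n.+1.-tuple RT :=
  [tuple of z.1 :: z.2].

Lemma measurable_tuple_cons n : measurable_fun setT (@tuple_cons n).
Proof. exact: measurable_cons. Qed.

HB.instance Definition _ n :=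
  isMeasurableFun.Build _ _ _ _ (@tuple_cons n) (@measurable_tuple_cons n).

Section succ.
Variables (n : nat) (mu : {sigma_finite_measure set (n.-tuple RT) -> \bar R}).

Definition borel_lebesgue_succ : set (n.+1.-tuple RT) -> \bar R :=
  pushforward (lebesgue_measure \x mu)%E (@tuple_cons n).

Let succ0 : borel_lebesgue_succ set0 = 0%E.
Proof. by rewrite /borel_lebesgue_succ /pushforward preimage_set0 measure0. Qed.

Let succ_ge0 A : (0 <= borel_lebesgue_succ A)%E.
Proof. exact: (measure_ge0 (lebesgue_measure \x mu)%E). Qed.

Let succ_sigma_additive : semi_sigma_additive borel_lebesgue_succ.
Proof. exact: measure_semi_sigma_additive. Qed.

HB.instance Definition _ := isMeasure.Build _ _ _ borel_lebesgue_succ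
  succ0 succ_ge0 succ_sigma_additive.

Let succ_sigma_finite : sigma_finite setT borel_lebesgue_succ.
Proof.
have /sigma_finiteP[F [TF ndF Foo]] := sigma_finiteT (@lebesgue_measure R).
have /sigma_finiteP[G [TG ndG Goo]] := sigma_finiteT mu.
pose uncons (x : n.+1.-tuple RT) : (RT * n.-tuple RT)%type :=
  (thead x, [tuple of behead x]).
have consK z : uncons (tuple_cons z) = z.
  by case: z => a t; congr pair; exact: val_inj.
have munc : measurable_fun setT uncons.
  apply: measurable_fun_pair; first exact: measurable_tnth.
  exact: measurable_behead.
exists (fun i => uncons @^-1` (F i `*` G i)).
  rewrite -preimage_bigcup predeqE => x; split => // _ /=.
  have [i _ Fi] : (\bigcup_i F i) (thead x) by rewrite -TF.
  have [j _ Gj] : (\bigcup_i G i) [tuple of behead x] by rewrite -TG.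
  exists (maxn i j) => //; split => /=.
    by move: Fi; exact/subsetPset/ndF/leq_maxl.
  by move: Gj; exact/subsetPset/ndG/leq_maxr.
move=> i; have [mF Fy] := Foo i; have [mG Gy] := Goo i.
have mFG : measurable (F i `*` G i) by exact: measurableX.
split; first by rewrite -[X in measurable X]setTI; exact: munc.
rewrite /borel_lebesgue_succ /pushforward.
rewrite (_ : _ @^-1` _ = F i `*` G i).
  by rewrite product_measure1E// lte_mul_pinfty// ge0_fin_numE.
rewrite predeqE => z.
by rewrite -[in X in _ <-> X](consK z).
Qed.

HB.instance Definition _ := Measure_isSigmaFinite.Build _ _ _
  borel_lebesgue_succ succ_sigma_finite.

End succ.

(* Lebesgue measure on the Borel sets of R^n, as an n-fold product measure. *)
Fixpoint borel_lebesgue n : {sigma_finite_measure set (n.-tuple RT) -> \bar R} :=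
  if n is n'.+1 then borel_lebesgue_succ (borel_lebesgue n')
  else \d_([tuple] : 0.-tuple RT).

End borel_lebesgue.

Section euclidean_space.
Variables (R : realType) (N : nat).

(* R^N with its Lebesgue-measurable sets: Caratheodory measurability for the
   outer measure induced by borel_lebesgue completes the Borel sigma-algebra. *)
Definition eucl : Type := caratheodory_type (mu_ext (@borel_lebesgue R N)).

HB.instance Definition _ := Measurable.on eucl.

Definition lebesgueN : set eucl -> \bar R :=
  @completed_measure_extension _ _ _ (@borel_lebesgue R N).

HB.instance Definition _ := Measure.on lebesgueN.

Let lebesgueN_sigma_finite : sigma_finite setT lebesgueN.
Proof. exact/completed_measure_extension_sigma_finite/sigma_finiteT. Qed.

HB.instance Definition _ := Measure_isSigmaFinite.Build _ _ _ lebesgueN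
  lebesgueN_sigma_finite.

Definition coords (x : eucl) : 'I_N -> R :=
  tnth (x : N.-tuple (measurableTypeR R)).

Definition edist (x y : eucl) : R :=
  Num.sqrt (\sum_(i < N) (coords x i - coords y i) ^+ 2).

Definition eball (x : eucl) (r : R) : set eucl := [set y | edist x y < r].

Definition ebounded (U : set eucl) :=
  exists M, forall x y, U x -> U y -> edist x y <= M.

(* The suprema below are real suprema: they are meant for bounded U, and
   sup set0 = 0, so that inradius U = 0 when U contains no ball. *)
Definition diameter (U : set eucl) : R :=
  sup [set d | exists x y, [/\ U x, U y & d = edist x y]].

Definition inradius (U : set eucl) : R :=
  sup [set r | 0 < r /\ exists x, eball x r `<=` U].

(* P^k(U). A function on U is represented by its extension by 0 outside U;
   msize is 1 + the total degree, and msize 0 = 0. *)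
Definition polyfun (k : nat) (U : set eucl) : set (eucl -> R) :=
  [set v | exists2 q : mpoly.mpoly N R, (mpoly.msize q <= k.+1)%N
         & v = (fun x => mpoly.meval (coords x) q) \_ U].

Definition is_l2proj (k : nat) (U : set eucl) (w u : eucl -> R) :=
  polyfun k U u /\
  forall v, polyfun k U v ->
    (\int[lebesgueN]_(x in U) (u x * v x)%:E =
     \int[lebesgueN]_(x in U) (w x * v x)%:E)%E.

(* The L^2-projection of w, by definite description. For w in L^1(U) with U
   bounded, measurable and of positive inradius, exactly one u satisfies
   is_l2proj k U w u; the default value 0 only serves to make l2proj total. *)
Definition l2proj (k : nat) (U : set eucl) (w : eucl -> R) : eucl -> R :=
  xget (fun=> 0) [set u | is_l2proj k U w u].

Definition normLp (p : \bar R) (U : set eucl) (f : eucl -> R) : \bar R :=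
  'N[lebesgueN]_p[EFin \o (f \_ U)].

Definition memLp (p : \bar R) (U : set eucl) (f : eucl -> R) :=
  measurable_fun U f /\ (normLp p U f < +oo)%E.

End euclidean_space.

(* Main.v *)
Require Import Defs.
From HB Require Import structures.
From mathcomp Require Import all_boot all_order all_algebra.
From mathcomp Require Import all_classical all_reals all_analysis.
From mathcomp Require Import measurable_realfun ess_sup_inf qpoly ring lra.
From mathcomp Require mpoly.
Import (canonicals, coercions) mpoly.
Set Implicit Arguments.
Unset Strict Implicit.
Unset Printing Implicit Defensive.
Import Order.TTheory GRing.Theory Num.Theory.
Import numFieldNormedType.Exports.
Local Open Scope classical_set_scope.
Local Open Scope ring_scope.

(* Testing the definition of the projection u of g with v = u gives
   |u|_2^2 = int_U g u <= |u|_oo |g|_1. Since U lies between two concentric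
   cubes of comparable sides, polynomials of degree at most k satisfy an
   inverse estimate |u|_oo^2 |U| <= C |u|_2^2 with C depending only on N, k and
   delta, so that |u|_oo |U| <= C |g|_1, and Hoelder's inequality gives the
   bound in L^p. The inverse estimate follows from Lagrange interpolation in
   one variable, applied to one variable at a time by Tonelli's theorem. *)

(** * The inverse estimate in one variable *)

(** In Lagrange's formula each of the n + 1 basis polynomials is, at x, a product of n quotients (x
    - t_j) / (t_i - t_j), and each quotient is at most B / s in absolute value. *)
Lemma normr_horner_le_nodes (F : realFieldType) (n : nat) (t : nat -> F)
    (p : {poly F}) (s B m x : F) :
  (size p <= n.+1)%N -> 0 < s ->
  (forall i j, i != j -> s <= `|t i - t j|) ->
  (forall i, (i < n.+1)%N -> `|x - t i| <= B) ->
  (forall i, (i < n.+1)%N -> `|p.[t i]| <= m) ->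
  `|p.[x]| <= m * (B / s) ^+ n *+ n.+1.
Proof.
move=> sp s0 sep tB tm.
have t_inj : injective t.
  move=> i j tij; apply/eqP/negPn/negP => /sep.
  by rewrite tij subrr normr0 leNgt s0.
rewrite [in leLHS](lagrange_gen (ltn0Sn n) t_inj sp) horner_sum.
rewrite (le_trans (ler_norm_sum _ _ _))//.
rewrite -[n.+1 in leRHS]card_ord -sumr_const; apply: ler_sum => i _.
rewrite hornerM hornerC normrM ler_pM// ?tm ?ltn_ord// lagrangeE//=.
rewrite hornerM hornerC !horner_prod -prodfV -big_split/= normr_prod.
have cn : #|[pred j : 'I_n.+1 | j != i]| = n by rewrite cardC1 card_ord.
rewrite -[X in _ <= _ ^+ X]cn -prodr_const; apply: ler_prod => j /= ji.
rewrite normr_ge0 !hornerXsubC normrM normfV mulrC ler_pM ?invr_ge0//.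
  by rewrite tB// ltn_ord.
have sij : s <= `|t i - t j| by rewrite sep// eq_sym.
by rewrite lef_pV2 ?posrE// (lt_le_trans s0 sij).
Qed.

(* The interpolation nodes minimise |p| on k + 1 separated subintervals of
   length s, so that s * p(t_i)^2 is at most the integral of p^2. *)
Lemma sqr_horner_le_integral (R : realType) (k : nat) (L : R) : 0 <= L ->
  exists2 K : R, 0 <= K & forall (p : {poly R}) (a rho x : R),
    (size p <= k.+1)%N -> 0 < rho -> `|x - a| <= L * rho ->
    ((p.[x] ^+ 2 * rho)%:E <=
     K%:E * \int[lebesgue_measure]_(t in `[(a - rho)%R, (a + rho)%R])
              (p.[t] ^+ 2)%:E)%E.
Proof.
(* The interpolation bound is used with B = (L + 1) * rho and s = rho / (k + 1), so B / s = (L + 1)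
   * (k + 1) and [q] does not depend on rho. The extra factor k + 1 in the constant is rho / s. *)
move=> L0; pose q : R := ((L + 1) * k.+1%:R) ^+ k *+ k.+1.
have q0 : 0 < q.
  by rewrite pmulrn_lgt0// exprn_gt0// mulr_gt0// ltr_wpDl.
exists (q ^+ 2 * k.+1%:R); first by rewrite mulr_ge0 ?sqr_ge0.
move=> p a rho x sp rho0 xa.
set J := (\int[_]_(t in _) _)%E.
have J0 : (0 <= J)%E by apply: integral_ge0 => t _; rewrite lee_fin sqr_ge0.
have mp2 (D : set R) : measurable_fun D (EFin \o (fun t => p.[t] ^+ 2)).
  apply/measurable_EFinP; apply: measurable_funX.
  by apply: measurable_funTS; apply: continuous_measurable_fun;
    exact: continuous_horner.
pose s := rho / k.+1%:R.
have s0 : 0 < s by rewrite divr_gt0.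
have rhoE : rho = s * k.+1%:R by rewrite divfK.
(* The interval of length 2 * rho is cut into 2 * (k + 1) pieces of length s and every other piece
   is kept, so points of distinct kept pieces are at least s apart. *)
pose c i := a - rho + (i.*2)%:R * s.
have min_ex i : exists t, t \in `[c i, (c i + s)%R] /\
    forall y, y \in `[c i, (c i + s)%R] -> p.[t] ^+ 2 <= p.[y] ^+ 2.
  have [||t t1 t2] := @EVT_min R (fun y => p.[y] ^+ 2) (c i) (c i + s).
  - by rewrite lerDl ltW.
  - apply: continuous_subspaceT => y.
    by apply: continuousM; exact: continuous_horner.
  - by exists t.
have [t tP] := choice min_ex.
have tI i : c i <= t i <= c i + s by have [] := tP i; rewrite in_itv.
have cI i y : (i < k.+1)%N -> c i <= y <= c i + s -> a - rho <= y <= a + rho.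
  rewrite /c => ik /andP[cy yc].
  have h : (i.*2)%:R * s + s <= 2 * rho.
    have : (i.*2.+1)%:R * s <= (k.+1.*2)%:R * s.
      by rewrite ler_pM2r// ler_nat ltn_double.
    by rewrite -natr1 mulrDl mul1r -[k.+1.*2]mul2n natrM -mulrA
      [k.+1%:R * s]mulrC -rhoE.
  have h2 : 0 <= (i.*2)%:R * s by rewrite mulr_ge0// ltW.
  by apply/andP; split; lra.
have node i : (i < k.+1)%N -> ((p.[t i] ^+ 2 * s)%:E <= J)%E.
  move=> ik; pose D := `[c i, (c i + s)%R]%classic.
  have mD : measurable D by exact: measurable_itv.
  have muD : lebesgue_measure D = s%:E.
    rewrite lebesgue_measure_itv/= lte_fin ltrDl s0.
    by rewrite -EFinD addrAC subrr add0r.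
  apply: (@le_trans _ _ (\int[lebesgue_measure]_(y in D) (p.[y] ^+ 2)%:E)%E).
    rewrite EFinM -muD -integral_cst//; apply: ge0_le_integral => //=.
    - by move=> y _; rewrite lee_fin sqr_ge0.
    - exact: mp2.
    - by move=> y Dy; rewrite lee_fin; apply (tP i).2.
  apply: ge0_subset_integral => //= [|y _|y]; first exact: mp2.
    by rewrite lee_fin sqr_ge0.
  by rewrite /D /= !in_itv/=; exact: cI.
(* If the integral is infinite, so is the right-hand side, the constant being positive. *)
case: J J0 node => [j| |//] J0 node; last first.
  by rewrite gt0_muley ?leey// lte_fin mulr_gt0// exprn_gt0.
rewrite -EFinM lee_fin; rewrite lee_fin in J0.
have tIab i : (i < k.+1)%N -> a - rho <= t i <= a + rho.
  by move=> ik; exact: cI (tI i).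
have sep i j' : i != j' -> s <= `|t i - t j'|.
  wlog ij : i j' / (i < j')%N.
    move=> W; rewrite neq_ltn => /orP[] h.
      by apply: W => //; rewrite ltn_eqF.
    by rewrite distrC; apply: W => //; rewrite ltn_eqF.
  move=> _; rewrite distrC.
  have /andP[_ h1] := tI i; have /andP[h2 _] := tI j'.
  have : (i.*2.+2)%:R * s <= (j'.*2)%:R * s.
    by rewrite ler_pM2r// ler_nat -doubleS leq_double.
  rewrite -addn2 natrD mulrDl /c in h1 h2 * => h3.
  by apply: le_trans (ler_norm _); lra.
have tB i : (i < k.+1)%N -> `|x - t i| <= (L + 1) * rho.
  move=> /tIab/andP[h1 h2].
  rewrite -(subrKA a) mulrDl mul1r (le_trans (ler_normD _ _))// lerD//.
  by rewrite ler_distlC h1 h2.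
have tm i : (i < k.+1)%N -> `|p.[t i]| <= Num.sqrt (j / s).
  move=> ik; rewrite -sqrtr_sqr ler_wsqrtr// ler_pdivlMr//.
  by rewrite -lee_fin node.
have := normr_horner_le_nodes sp s0 sep tB tm.
have -> : (L + 1) * rho / s = (L + 1) * k.+1%:R.
  by rewrite rhoE mulrA mulrAC mulfK// gt_eqF.
rewrite -mulrnAr -/q => /(@lerXn2r _ 2) h.
rewrite -real_normK ?num_real//.
apply: (@le_trans _ _ ((Num.sqrt (j / s) * q) ^+ 2 * rho)).
  by rewrite ler_pM2r// h// nnegrE// mulr_ge0// ?sqrtr_ge0// ltW.
rewrite exprMn sqr_sqrtr; last by rewrite divr_ge0// ltW.
suff -> : j / s * q ^+ 2 * rho = q ^+ 2 * k.+1%:R * j by [].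
by rewrite rhoE; field; rewrite gt_eqF.
Qed.

(** * Cubes and Tonelli's theorem for the iterated product measure *)

Section tuple_cubes.
Context {R : realType}.
Local Notation RT := (measurableTypeR R).

Definition cube n (a : n.-tuple RT) (h : R) : set (n.-tuple RT) :=
  [set x | forall i, `|tnth x i - tnth a i| <= h].

Lemma measurable_cube n (a : n.-tuple RT) h : measurable (cube a h).
Proof.
have -> : cube a h = \bigcap_(i in [set: 'I_n])
    ((fun x => tnth x i) @^-1` `[tnth a i - h, tnth a i + h]%classic).
  apply/seteqP; split => x /= H i.
    by move=> _; rewrite /= in_itv/= -ler_distl.
  by rewrite ler_distl; have := H i I; rewrite /= in_itv.
apply: fin_bigcap_measurable => // i _.
rewrite -[X in measurable X]setTI.
by apply: measurable_tnth => //; exact: measurable_itv.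
Qed.

Lemma cube_tuple_cons n (a1 : R) (a : n.-tuple RT) h :
  @tuple_cons R n @^-1` cube (tuple_cons (a1, a)) h =
  `[a1 - h, a1 + h]%classic `*` cube a h.
Proof.
apply/seteqP; split => -[t y] /=.
  move=> H; split => /=.
    by rewrite in_itv/= -ler_distl; have := H ord0; rewrite !(tnth_nth 0).
  by move=> i; have := H (lift ord0 i); rewrite !(tnth_nth 0).
move=> [/=]; rewrite in_itv/= -ler_distl => H1 H2 i.
rewrite !(tnth_nth 0)/=; case: i => -[|i]//= ii.
by have := H2 (Ordinal (ii : (i < n)%N)); rewrite !(tnth_nth 0).
Qed.

Lemma tuple_consE n (x : n.+1.-tuple RT) :
  x = tuple_cons (thead x, [tuple of behead x]).
Proof. by apply: val_inj; case: x => -[|y s]. Qed.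

Lemma borel_lebesgue_cube n (a : n.-tuple RT) h : 0 <= h ->
  borel_lebesgue n (cube a h) = ((2 * h) ^+ n)%:E.
Proof.
move=> h0; elim: n a => [a|n IH a].
  rewrite /= diracE mem_set ?expr0//.
  by move=> [].
rewrite (tuple_consE a) /= /borel_lebesgue_succ /pushforward cube_tuple_cons.
rewrite product_measure1E//; last exact: measurable_cube.
rewrite [X in (_ * X)%E]IH [X in (X * _)%E]lebesgue_measure_itv/= lte_fin.
case: ltP => [_|hh].
  by rewrite -EFinD -EFinM exprS; congr (_ * _)%:E; ring.
(* The interval formula tests for strictly ordered endpoints. The remaining case is a degenerate
   cube, where both sides vanish. *)
have -> : h = 0 by apply/le_anti; rewrite h0 andbT; lra.
by rewrite mul0e mulr0 expr0n.
Qed.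

(** The measure in dimension n + 1 is the image of a product measure under [tuple_cons], and the
    cube pulls back to a product set, so Tonelli's theorem applies to f extended by 0. *)
Lemma integral_borel_lebesgue_cube n (a1 : R) (a : n.-tuple RT) h
    (f : n.+1.-tuple RT -> \bar R) :
  measurable_fun setT f -> (forall x, 0 <= f x)%E ->
  (\int[borel_lebesgue n.+1]_(x in cube (tuple_cons (a1, a)) h) f x =
   \int[lebesgue_measure]_(t in `[(a1 - h)%R, (a1 + h)%R])
     \int[borel_lebesgue n]_(y in cube a h) f (tuple_cons (t, y)))%E.
Proof.
move=> mf f0.
have mF : measurable_fun setT (f \o @tuple_cons R n).
  exact: measurableT_comp.
transitivity (\int[lebesgue_measure \x borel_lebesgue n]_(z in
    `[(a1 - h)%R, (a1 + h)%R]%classic `*` cube a h) (f \o @tuple_cons R n) z)%E.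
  rewrite -cube_tuple_cons; apply: ge0_integral_pushforward => //.
  - exact: measurable_cube.
  - exact: measurable_funTS.
rewrite integral_mkcond fubini_tonelli1//; last 2 first.
- apply/(measurable_restrictT _ _).1; last exact: measurable_funTS.
  apply: measurableX => //; exact: measurable_cube.
- by move=> z; apply: erestrict_ge0 => y _; exact: f0.
rewrite [RHS]integral_mkcond; apply: eq_integral => t _.
rewrite /fubini_F [RHS]patchE; case: ifPn => tI; last first.
  rewrite integral0_eq// => y _; rewrite patchE ifF//.
  by apply/negbTE; apply: contraNN tI; rewrite !inE => -[].
rewrite [RHS]integral_mkcond; apply: eq_integral => y _.
by rewrite !patchE in_setX tI.
Qed.

Lemma measurable_integral_cube n (a : n.-tuple RT) h
    (f : n.+1.-tuple RT -> \bar R) :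
  measurable_fun setT f -> (forall x, 0 <= f x)%E ->
  measurable_fun [set: RT]
    (fun t => \int[borel_lebesgue n]_(y in cube a h) f (tuple_cons (t, y)))%E.
Proof.
move=> mf f0.
(* With f cut off outside the cube in the last n variables, the inner integral becomes a section
   integral [fubini_F], whose measurability is part of Tonelli's theorem. *)
pose F := (f \o @tuple_cons R n) \_ (setT `*` cube a h).
have mF : measurable_fun setT F.
  apply/(measurable_restrictT _ _).1.
    by apply: measurableX => //; exact: measurable_cube.
  by apply: measurable_funTS; apply: measurableT_comp.
rewrite (_ : (fun t => _) = fubini_F (borel_lebesgue n) F).
  apply: measurable_fun_fubini_tonelli_F => // z; apply: erestrict_ge0 => y _;
    exact: f0.
apply/funext => t; rewrite /fubini_F [LHS]integral_mkcond;
  apply: eq_integral => y _.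
by rewrite /F !patchE in_setX in_setT.
Qed.

End tuple_cubes.

(** * Polynomials in several variables and the inverse estimate on cubes *)

Section monomial_sums.
Context {R : realType} {k : nat}.
Local Notation RT := (measurableTypeR R).

(* Polynomial functions of degree at most k in each variable; the i-th exponent
   function lists a term's exponents, of which only the first n are used. *)
Definition monomial_sum (s : seq (R * (nat -> 'I_k.+1))) n
    (x : n.-tuple RT) : R :=
  \sum_(m <- s) m.1 * \prod_(i < n) tnth x i ^+ m.2 i.

Lemma measurable_monomial_sum s n : measurable_fun setT (@monomial_sum s n).
Proof.
apply: measurable_sum => m; apply: measurable_funM => //.
apply: measurable_prod => i _; apply: measurable_funX.
exact: measurable_tnth.
Qed.

(** The power of the fixed first variable goes into the coefficient, and composition with [S] shifts
    the other exponents. With [monomial_sum_head] this separates the variables for an induction on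
    n. *)
Lemma monomial_sum_tail s n t : exists s', forall x : n.-tuple RT,
  monomial_sum s (tuple_cons (t, x)) = monomial_sum s' x.
Proof.
pose slice (m : R * (nat -> 'I_k.+1)) : R * (nat -> 'I_k.+1) :=
  (m.1 * t ^+ m.2 0%N, m.2 \o S).
exists (map slice s) => x.
rewrite /monomial_sum big_map; apply: eq_bigr => m _ /=.
rewrite big_ord_recl mulrA; congr (_ * _ * _).
by apply: eq_bigr => i _; rewrite !(tnth_nth 0).
Qed.

Lemma monomial_sum_head s n (x : n.-tuple RT) :
  exists2 p : {poly R}, (size p <= k.+1)%N &
    forall t, monomial_sum s (tuple_cons (t, x)) = p.[t].
Proof.
exists (\sum_(m <- s)
  (m.1 * \prod_(i < n) tnth x i ^+ m.2 i.+1) *: 'X^(m.2 0%N)).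
  rewrite (leq_trans (size_sum _ _ _))//; apply/bigmax_leqP_seq => m _ _.
  by rewrite (leq_trans (size_scale_leq _ _))// size_polyXn ltn_ord.
move=> t; rewrite horner_sum; apply: eq_bigr => m _.
rewrite big_ord_recl hornerZ hornerXn [in LHS]mulrCA [in LHS]mulrC;
  congr (_ * _ * _).
by apply: eq_bigr => i _; rewrite !(tnth_nth 0).
Qed.

(** On the cube the i-th coordinate is at most |a_i| + h in absolute value. This bound serves to
    show that a polynomial is square integrable on a bounded set. *)
Lemma monomial_sum_bounded s n (a : n.-tuple RT) h : exists M : R,
  forall x, cube a h x -> `|monomial_sum s x| <= M.
Proof.
exists (\sum_(m <- s) `|m.1| * \prod_(i < n) (`|tnth a i| + h) ^+ m.2 i) =>
  x ax.
rewrite (le_trans (ler_norm_sum _ _ _))//; apply: ler_sum => m _.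
rewrite normrM ler_wpM2l// normr_prod; apply: ler_prod => i _.
rewrite normr_ge0 normrX lerXn2r ?nnegrE//.
  by rewrite addr_ge0// (le_trans _ (ax i)).
rewrite -[tnth x i](subrK (tnth a i)) addrC.
by rewrite (le_trans (ler_normD _ _))// lerD2l.
Qed.

(** Induction on n: the one-variable estimate is applied to the first coordinate with the others
    fixed at those of x, then the induction hypothesis under the integral sign. Each variable
    contributes one factor K and one factor rho. *)
Lemma sqr_monomial_sum_le_integral (L K : R) : 0 <= K ->
  (forall (p : {poly R}) (a rho x : R),
    (size p <= k.+1)%N -> 0 < rho -> `|x - a| <= L * rho ->
    ((p.[x] ^+ 2 * rho)%:E <=
     K%:E * \int[lebesgue_measure]_(t in `[(a - rho)%R, (a + rho)%R])
              (p.[t] ^+ 2)%:E)%E) ->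
  forall s n (a x : n.-tuple RT) rho, 0 < rho -> cube a (L * rho) x ->
    ((monomial_sum s x ^+ 2 * rho ^+ n)%:E <=
     (K ^+ n)%:E * \int[borel_lebesgue n]_(y in cube a rho)
                     (monomial_sum s y ^+ 2)%:E)%E.
Proof.
move=> K0 HK s n a x rho rho0; elim: n s a x => [|n IH] s a x.
  (* In dimension 0 the measure is the Dirac mass at the empty tuple, and the estimate is an
     equality. *)
  move=> _; rewrite expr0 mulr1 mul1e /=.
  rewrite integral_dirac//; last 2 first.
  - exact: measurable_cube.
  - apply/measurable_EFinP; apply: measurable_funX; apply: measurable_funTS.
    exact: measurable_monomial_sum.
  rewrite diracE mem_set ?mul1e; last by move=> [].
  by rewrite (tuple0 x).
rewrite (tuple_consE a) (tuple_consE x).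
move: (thead a) (thead x) [tuple of behead a] [tuple of behead x] =>
  a1 x1 a' x' ax.
have ax1 : `|x1 - a1| <= L * rho by have := ax ord0; rewrite !(tnth_nth 0).
have ax' : cube a' (L * rho) x'.
  by move=> i; have := ax (lift ord0 i); rewrite !(tnth_nth 0).
have ms m : measurable_fun setT
    (fun y : m.-tuple RT => (monomial_sum s y ^+ 2)%:E).
  apply/measurable_EFinP; apply: measurable_funX.
  exact: measurable_monomial_sum.
rewrite integral_borel_lebesgue_cube//; last first.
  by move=> y; rewrite lee_fin sqr_ge0.
have [p sp pE] := monomial_sum_head s x'.
have mp : measurable_fun [set: RT] (fun t => (p.[t] ^+ 2)%:E).
  apply/measurable_EFinP; apply: measurable_funX.
  by apply: continuous_measurable_fun; exact: continuous_horner.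
pose G t := (\int[borel_lebesgue n]_(y in cube a' rho)
  (monomial_sum s (tuple_cons (t, y)) ^+ 2)%:E)%E.
have mG : measurable_fun [set: RT] G.
  apply: (@measurable_integral_cube R n a' rho
    (fun y => (monomial_sum s y ^+ 2)%:E)) => //.
  by move=> y; rewrite lee_fin sqr_ge0.
have G0 t : (0 <= G t)%E by apply: integral_ge0 => y _; rewrite lee_fin sqr_ge0.
(* Since p(t) is the value at (t, x'), this is the induction hypothesis at x' for the slice with
   first coordinate t. *)
have pG t : ((rho ^+ n)%:E * (p.[t] ^+ 2)%:E <= (K ^+ n)%:E * G t)%E.
  have [s' s'E] := monomial_sum_tail s n t.
  rewrite -EFinM mulrC -pE s'E (le_trans (IH s' _ _ ax'))// lee_wpmul2l//.
    by rewrite lee_fin exprn_ge0.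
  by rewrite /G; under [leRHS]eq_integral do rewrite s'E.
have rhon0 : 0 <= rho ^+ n by rewrite exprn_ge0// ltW.
rewrite pE [rho ^+ _]exprS mulrA EFinM.
apply: (@le_trans _ _ (((K%:E * \int[lebesgue_measure]_(t in
    `[(a1 - rho)%R, (a1 + rho)%R]) (p.[t] ^+ 2)%:E) * (rho ^+ n)%:E)%E)).
  by rewrite lee_wpmul2r ?lee_fin// HK.
rewrite -muleA [K ^+ _]exprS EFinM -muleA lee_wpmul2l ?lee_fin// muleC.
rewrite -ge0_integralZl//; last 2 first.
- exact: measurable_funTS.
- by move=> t _; rewrite lee_fin sqr_ge0.
have <- : (\int[lebesgue_measure]_(t in `[(a1 - rho)%R, (a1 + rho)%R])
    ((K ^+ n)%:E * G t) = (K ^+ n)%:E *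
    \int[lebesgue_measure]_(t in `[(a1 - rho)%R, (a1 + rho)%R]) G t)%E.
  by rewrite ge0_integralZl// ?lee_fin ?exprn_ge0//; exact: measurable_funTS.
apply: ge0_le_integral => //.
- by move=> t _; rewrite -EFinM lee_fin mulr_ge0// sqr_ge0.
- by apply: measurable_funeM; exact: measurable_funTS.
- by apply: measurable_funeM; exact: measurable_funTS.
Qed.

End monomial_sums.

(** * Comparison of L^p norms on a set of finite measure *)

(** The convention 1 / oo = 0 lets the powers of V below cover p = oo as well. *)
Definition recip {R : realType} (p : \bar R) : R :=
  if p is r%:E then r^-1 else 0.

Section Lnorm_finite_support.
Context {d} {T : measurableType d} {R : realType}.
Context (mu : {measure set T -> \bar R}) (U : set T) (V : R).
Context (mU : measurable U) (muU : mu U = V%:E) (V_gt0 : 0 < V).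

Let muT_gt0 : (0 < mu [set: T])%E.
Proof.
apply: (@lt_le_trans _ _ (mu U)); first by rewrite muU lte_fin.
by apply: le_measure; rewrite ?inE.
Qed.

Lemma Lnorm_le_of_bounded (p : \bar R) (S : R) (u : T -> R) :
  (1 <= p)%E -> measurable_fun setT u -> (forall x, ~ U x -> u x = 0) ->
  0 <= S -> (forall x, `|u x| <= S) ->
  ('N[mu]_p[EFin \o u] <= (S * V `^ recip p)%:E)%E.
Proof.
move=> p1 mf u0 S0 uS; case: p p1 => [r| |//]; last first.
  move=> _; rewrite unlock muT_gt0 powRr0 mulr1.
  by apply/ess_supP/nearW => x /=; rewrite lee_fin.
rewrite lee_fin => r1; have r0 : 0 < r by rewrite (lt_le_trans _ r1).
(* For finite p = r the bound is the r-th root of the integral of S^r over U. *)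
have -> : ((S * V `^ recip r%:E)%:E = ((S `^ r)%:E * mu U) `^ r^-1)%E.
  rewrite muU -EFinM poweR_EFin powRM ?powR_ge0 ?ltW//.
  by rewrite -powRrM mulfV ?gt_eqF// powRr1.
rewrite unlock; apply: gt0_ler_poweR.
- by rewrite invr_ge0 ltW.
- by rewrite in_itv/= leey andbT; apply: integral_ge0 => x _;
    rewrite lee_fin powR_ge0.
- by rewrite in_itv/= leey andbT mule_ge0// lee_fin powR_ge0.
rewrite -integral_cst// [leRHS]integral_mkcond; apply: ge0_le_integral => //.
- by move=> x _; rewrite poweR_ge0.
- apply/measurable_EFinP.
  apply: (@measurableT_comp _ _ _ _ _ _ (@powR R ^~ r) _ (fun x => `|u x|)).
    exact: measurable_powR.
  exact: measurableT_comp.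
- by apply/(measurable_restrictT _ _).1.
move=> x _; rewrite patchE /=; case: ifPn.
  by move=> _; rewrite lee_fin ge0_ler_powR ?nnegrE// ltW.
by move/negP => xU; rewrite u0 ?normr0 ?powR0 ?gt_eqF// => ?; apply: xU;
  rewrite inE.
Qed.

(** For 1 < p < oo this is Hoelder's inequality for g times the indicator of U. For p = oo, |g| is
    almost everywhere at most its essential supremum, which is integrated over U; for p = 1 the
    power of V is 1. *)
Lemma Lnorm1_le_Lnorm (p : \bar R) (g : T -> R) :
  (1 <= p)%E -> measurable_fun setT g -> (forall x, ~ U x -> g x = 0) ->
  ('N[mu]_1[EFin \o g] <= 'N[mu]_p[EFin \o g] * (V `^ (1 - recip p))%:E)%E.
Proof.
move=> p1 mg g0.
have gU x : x \notin U -> g x = 0.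
  by move/negP => xU; apply: g0 => Ux; apply: xU; rewrite inE.
case: p p1 => [r| |//]; last first.
  move=> _; rewrite subr0 powRr1 ?Lnorm1; last exact: ltW.
  have N0 : (0 <= 'N[mu]_+oo[EFin \o g])%E by exact: Lnorm_ge0.
  rewrite -muU.
  have [Noo|Nfin] := eqVneq ('N[mu]_+oo[EFin \o g])%E +oo%E.
    by rewrite Noo gt0_mulye ?leey// muU lte_fin.
  have : ('N[mu]_+oo[EFin \o g] \is a fin_num)%E
    by rewrite ge0_fin_numE// lt_neqAle Nfin leey.
  move=> /fineK <-; rewrite -integral_cst// [leRHS]integral_mkcond.
  apply: ae_ge0_le_integral => //.
  - by apply: measurableT_comp => //; exact/measurable_EFinP.
  - by move=> x _; apply: erestrict_ge0 => y _ /=; rewrite lee_fin fine_ge0.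
  - by apply/(measurable_restrictT _ _).1.
  have := ess_sup_ge mu (abse \o (EFin \o g)).
  apply: filterS => x /= xs _; rewrite patchE; case: ifPn => [_|/gU ->];
    last by rewrite normr0.
  rewrite /= fineK ?ge0_fin_numE ?lt_neqAle ?Nfin ?leey//.
  by rewrite unlock muT_gt0.
rewrite lee_fin le_eqVlt => /orP[/eqP <-|r1].
  by rewrite /recip invr1 subrr powRr0 mule1.
have r0 : 0 < r by rewrite (lt_trans _ r1).
pose q := (1 - r^-1)^-1.
have q0 : 0 < q by rewrite invr_gt0 subr_gt0 invf_lt1.
have rq : r^-1 + q^-1 = 1 by rewrite /q invrK addrC subrK.
have m1 : measurable_fun setT (\1_U : T -> R) by exact: measurable_indic.
have -> : ('N[mu]_1[EFin \o g] = 'N[mu]_1[EFin \o (g \* \1_U)%R])%E.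
  apply: eq_Lnorm => x /=; rewrite indicE;
    case: (boolP (x \in U)) => [_|/gU ->].
    by rewrite mulr1.
  by rewrite mul0r.
apply: (le_trans (hoelder mu mg m1 r0 q0 rq)); rewrite lee_wpmul2l//.
  exact: Lnorm_ge0.
have -> : 1 - recip r%:E = recip q%:E
  by rewrite /recip/= -rq addrAC subrr add0r.
rewrite -[_ `^ _]mul1r; apply: Lnorm_le_of_bounded => //.
- by rewrite lee_fin invf_ge1 ?subr_gt0 ?invf_lt1// gerBl invr_ge0 ltW.
- by move=> x xU; rewrite indicE memNset.
- by move=> x; rewrite indicE; case: (x \in U); rewrite ?normr1 ?normr0.
Qed.

(* |u| V <= C |g|_1 is, up to powers of V, an L^1 to L^oo bound; Hoelder's
   inequality on a set of measure V turns it into an L^p bound. *)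
Lemma Lnorm_le_of_bounded_by_Lnorm1 (p : \bar R) (C S : R) (u g : T -> R) :
  (1 <= p)%E -> measurable_fun setT u -> measurable_fun setT g ->
  (forall x, ~ U x -> u x = 0) -> (forall x, ~ U x -> g x = 0) ->
  0 <= C -> 0 <= S -> (forall x, `|u x| <= S) ->
  ((S * V)%:E <= C%:E * 'N[mu]_1[EFin \o g])%E ->
  ('N[mu]_p[EFin \o u] <= C%:E * 'N[mu]_p[EFin \o g])%E.
Proof.
move=> p1 mf mg u0 g0 C0 S0 uS SV.
apply: (le_trans (Lnorm_le_of_bounded p1 mf u0 S0 uS)).
have V0 : V != 0 by rewrite gt_eqF.
(* In this form the power of V cancels the factor produced by Hoelder's inequality. *)
have -> : S * V `^ recip p = S * V * (V `^ (1 - recip p))^-1.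
  rewrite powRB ?V0 ?implybT// powRr1; last exact: ltW.
  by rewrite invf_div mulrA mulrAC mulfK.
rewrite EFinM; apply: (@le_trans _ _
   (C%:E * ('N[mu]_p[EFin \o g] * (V `^ (1 - recip p))%:E) *
     ((V `^ (1 - recip p))^-1)%:E)%E).
  rewrite lee_wpmul2r ?lee_fin ?invr_ge0 ?powR_ge0//.
  by apply: (le_trans SV); rewrite lee_wpmul2l ?lee_fin// Lnorm1_le_Lnorm.
by rewrite -!muleA -EFinM divff ?mule1// gt_eqF// powR_gt0.
Qed.

End Lnorm_finite_support.

(** * Passage between Borel and completed Lebesgue measure *)

Section completed_lebesgue.
Context {R : realType} {N : nat}.
Local Notation RT := (measurableTypeR R).
Local Notation mu := (@lebesgueN R N).

Lemma measurable_eucl (A : set (N.-tuple RT)) :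
  measurable A -> measurable (A : set (eucl R N)).
Proof. by move=> mA; apply: caratheodory_measurable_mu_ext. Qed.

Lemma measurable_fun_eucl d (T : measurableType d) (f : N.-tuple RT -> T) :
  measurable_fun setT f -> measurable_fun setT (f : eucl R N -> T).
Proof.
move=> mf _ Y mY; rewrite setTI; apply: measurable_eucl.
by rewrite -[X in measurable X]setTI; exact: mf.
Qed.

Lemma lebesgueN_borel (A : set (N.-tuple RT)) :
  measurable A -> mu A = borel_lebesgue N A.
Proof. by move=> mA; exact: measurable_mu_extE. Qed.

(** The identity from [eucl] to Borel tuples is measurable, and the image of [lebesgueN] under it
    agrees with [borel_lebesgue] on Borel sets. This carries the Tonelli estimates over to
    [lebesgueN]. *)
Lemma integral_lebesgueN_borel (A : set (N.-tuple RT))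
    (f : N.-tuple RT -> \bar R) :
  measurable A -> measurable_fun setT f -> (forall x, 0 <= f x)%E ->
  (\int[mu]_(x in A) f x = \int[borel_lebesgue N]_(x in A) f x)%E.
Proof.
move=> mA mf f0.
have mid : measurable_fun setT (idfun : eucl R N -> N.-tuple RT).
  by apply: measurable_fun_eucl; exact: measurable_id.
rewrite -[LHS](ge0_integral_pushforward mid)//; last exact: measurable_funTS.
apply: eq_measure_integral => B mB _; exact: lebesgueN_borel.
Qed.

End completed_lebesgue.

(** * The inverse estimate on U *)

Lemma meval_monomial_sum (R : realType) (N k : nat) (q : mpoly.mpoly N R) :
  (mpoly.msize q <= k.+1)%N ->
  exists s, forall x : eucl R N,
    mpoly.meval (coords x) q = monomial_sum (k := k) s x.
Proof.
move=> qk.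
pose term m : R * (nat -> 'I_k.+1) :=
  (mpoly.mcoeff m q, fun i => inord (nth 0%N (mpoly.multinom_val m) i)).
exists (map term (mpoly.msupp q)) => x.
rewrite mpoly.mevalE /monomial_sum [RHS]big_map [LHS]big_seq [RHS]big_seq.
apply: eq_bigr => m mq; congr (_ * _); apply: eq_bigr => i _.
(* Each exponent is at most the total degree of its monomial, hence at most k, so [inord] leaves it
   unchanged. *)
have -> : nat_of_ord ((term m).2 i) = mpoly.fun_of_multinom m i.
  rewrite /= inordK; first by rewrite /mpoly.fun_of_multinom (tnth_nth 0%N).
  rewrite -[nth _ _ _]/(nth 0%N _ (nat_of_ord i)) -tnth_nth.
  apply: leq_ltn_trans (leq_trans (mpoly.msize_mdeg_lt mq) qk).
  by rewrite mpoly.mdegE (bigD1 i)//= leq_addr.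
by [].
Qed.

(** A ball of radius r about a, with r above half the inradius, lies in U and contains the cube of
    half-side rho = r / (2 * N). Every point of U is within the diameter of a, and the diameter is
    at most inradius / delta < 2 * r / delta = (4 * N / delta) * rho. *)
Lemma cube_sandwich (R : realType) (N : nat) (delta : R) (U : set (eucl R N)) :
  (1 <= N)%N -> 0 < delta -> ebounded U -> delta <= inradius U / diameter U ->
  exists (a : eucl R N) (rho : R), [/\ 0 < rho, cube a rho `<=` U &
    U `<=` cube a (N%:R * 4 / delta * rho)].
Proof.
move=> N1 d0 [M UM] dU.
have edist_ge0 x y : 0 <= @Defs.edist R N x y by exact: sqrtr_ge0.
have diam_ge x y : U x -> U y -> Defs.edist x y <= diameter U.
  move=> Ux Uy; apply: ub_le_sup; last by exists x, y.
  by exists M => _ [x' [y' [Ux' Uy' ->]]]; exact: UM.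
have diam_ge0 : 0 <= diameter U.
  have [->|/set0P[x Ux]] := eqVneq U set0.
    by rewrite /diameter (_ : [set _ | _] = set0) ?sup0//; apply/seteqP;
      split => // d [x [y []]].
  exact: le_trans (diam_ge x x Ux Ux).
have diam_gt0 : 0 < diameter U.
  rewrite lt_neqAle diam_ge0 andbT; apply/negP => /eqP D0.
  (* Division by 0 yields 0, so a zero diameter would force delta <= 0. *)
  by move: dU; rewrite -D0 invr0 mulr0 leNgt d0.
have r_ge : delta * diameter U <= inradius U by rewrite -ler_pdivlMr.
have r_gt0 : 0 < inradius U by rewrite (lt_le_trans _ r_ge)// mulr_gt0.
(* Without a genuine supremum [sup] takes the value 0, contrary to [r_gt0]. *)
have hs : has_sup [set r | 0 < r /\ exists x, @eball R N x r `<=` U].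
  by apply/not_notP => /sup_out; rewrite -/(inradius U) => r0;
    rewrite r0 ltxx in r_gt0.
have e0 : 0 < inradius U / 2 by rewrite divr_gt0.
have [r [r0 [a aU]] rr] := sup_adherent e0 hs.
rewrite -/(inradius U) in rr.
have N0 : 0 < N%:R :> R by rewrite ltr0n.
exists a, (r / (2 * N%:R)); split.
- by rewrite divr_gt0// mulr_gt0.
- move=> x ax; apply: aU; rewrite /eball /= /Defs.edist.
  rewrite -[r]gtr0_norm// -sqrtr_sqr ltr_sqrt ?exprn_gt0//.
  apply: (@le_lt_trans _ _ (\sum_(i < N) (r / (2 * N%:R)) ^+ 2)).
    apply: ler_sum => i _; rewrite -real_normK ?num_real// lerXn2r ?nnegrE//.
      by rewrite divr_ge0 ?mulr_ge0// ltW.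
    by rewrite distrC; exact: ax.
  rewrite sumr_const card_ord -[X in X < _]mulr_natr expr_div_n mulrAC.
  rewrite ltr_pdivrMr ?exprn_gt0 ?mulr_gt0// ltr_pM2l ?exprn_gt0//.
  have N1' : 1 <= N%:R :> R by rewrite ler1n.
  nra.
- have Ua : U a.
    apply: aU; rewrite /eball /= /Defs.edist big1 ?sqrtr0// => i _.
    by rewrite subrr expr0n.
  move=> x Ux i.
  have -> : N%:R * 4 / delta * (r / (2 * N%:R)) = 2 * r / delta.
    by field; rewrite !gt_eqF.
  apply: (@le_trans _ _ (Defs.edist x a)).
    rewrite -sqrtr_sqr ler_wsqrtr// (bigD1 i)//= lerDl sumr_ge0// => j _.
    exact: sqr_ge0.
  apply: (le_trans (diam_ge _ _ Ux Ua)).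
  rewrite ler_pdivlMr// mulrC (le_trans r_ge)//; lra.
Qed.

(* |U| and rho ^ N are comparable, because U lies between two concentric cubes
   of half-sides rho and L * rho. *)
Lemma sqr_monomial_sum_measure_le (R : realType) (N k : nat) (L : R) : 0 <= L ->
  exists2 C : R, 0 <= C &
    forall s (U : set (eucl R N)) (a : eucl R N) (rho : R),
    measurable U -> 0 < rho -> cube a rho `<=` U -> U `<=` cube a (L * rho) ->
    forall x, U x ->
      ((monomial_sum (k := k) s x ^+ 2)%:E * @lebesgueN R N U <=
       C%:E * \int[@lebesgueN R N]_(y in U) (monomial_sum s y ^+ 2)%:E)%E.
Proof.
move=> L0; have [K K0 HK] := sqr_horner_le_integral k L0.
(* The factor (2 * L)^N comes from |U| <= (2 * L * rho)^N, and K^N from the estimate on cubes. *)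
exists ((2 * L) ^+ N * K ^+ N);
  first by rewrite mulr_ge0// exprn_ge0// mulr_ge0.
move=> s U a rho mU rho0 aU Ua x Ux.
have mf2 : measurable_fun setT
    (fun y : N.-tuple (measurableTypeR R) => (monomial_sum s y ^+ 2)%:E).
  apply/measurable_EFinP; apply: measurable_funX.
  exact: measurable_monomial_sum.
have f20 y : (0 <=
    (monomial_sum s (y : N.-tuple (measurableTypeR R)) ^+ 2)%:E)%E.
  by rewrite lee_fin sqr_ge0.
have UL : (@lebesgueN R N U <= ((2 * L) ^+ N * rho ^+ N)%:E)%E.
  rewrite -exprMn -mulrA -(borel_lebesgue_cube a) ?mulr_ge0 ?(ltW rho0)//.
  rewrite -lebesgueN_borel; last exact: measurable_cube.
  by apply: le_measure; rewrite ?inE//; apply: measurable_eucl;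
    exact: measurable_cube.
apply: (le_trans (lee_wpmul2l _ UL)) => //.
rewrite -EFinM mulrCA EFinM [in leRHS]EFinM -muleA.
rewrite lee_wpmul2l ?lee_fin ?exprn_ge0 ?mulr_ge0//.
apply: (le_trans (sqr_monomial_sum_le_integral K0 HK s rho0 (Ua _ Ux))).
rewrite lee_wpmul2l ?lee_fin ?exprn_ge0//.
rewrite -integral_lebesgueN_borel//; last exact: measurable_cube.
apply: ge0_subset_integral => //.
- by apply: measurable_eucl; exact: measurable_cube.
- by apply: measurable_funTS; exact: measurable_fun_eucl.
Qed.

(** * The bound for the projection *)

Theorem lemma3p2 (R : realType) (N k : nat) (delta : R) (p : \bar R)
    (N_ge1 : (1 <= N)%N) (delta_gt0 : 0 < delta) (p_ge1 : (1%:E <= p)%E) :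
  exists C : R, forall U : set (eucl R N),
    measurable U -> ebounded U -> delta <= inradius U / diameter U ->
    forall g : eucl R N -> R, memLp p U g ->
      (normLp p U (l2proj k U g) <= C%:E * normLp p U g)%E.
Proof.
have L0 : 0 <= N%:R * 4 / delta by rewrite divr_ge0 ?mulr_ge0// ltW.
have [C C0 HC] := sqr_monomial_sum_measure_le N k L0.
exists C => U mU bU dU g [mg _].
(* Either u is a projection of g, or [l2proj] has its default value 0 and the bound is trivial. *)
rewrite /l2proj; case: xgetP => [u _ [[q qk uq] uP]|_]; last first.
  rewrite /normLp (_ : EFin \o _ = cst 0%E).
    rewrite Lnorm0; last by rewrite gt_eqF// (lt_le_trans _ p_ge1).
    by rewrite mule_ge0// Lnorm_ge0.
  by apply/funext => x /=; rewrite patchE; case: ifP.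
have [a [rho [rho0 aU Ua]]] := cube_sandwich N_ge1 delta_gt0 bU dU.
have [s sE] := meval_monomial_sum qk.
have uf : u = (fun x : eucl R N => monomial_sum s x) \_ U.
  by rewrite uq; apply/funext => x; rewrite !patchE sE.
have uE : {in U, u =1 (fun x : eucl R N => monomial_sum s x)}.
  by move=> x xU; rewrite uf patchE xU.
have mf : measurable_fun setT (fun x : eucl R N => monomial_sum s x).
  by apply: measurable_fun_eucl; exact: measurable_monomial_sum.
have mu' : measurable_fun U u.
  rewrite uf; apply: measurable_funTS; apply/(measurable_restrictT _ _).1 => //.
  exact: measurable_funTS.
have mcube h : measurable (cube a h : set (eucl R N)).
  by apply: measurable_eucl; exact: measurable_cube.
have muU_lt : (@lebesgueN R N U < +oo)%E.
  apply: (@le_lt_trans _ _ (@lebesgueN R N (cube a (N%:R * 4 / delta * rho)))).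
    by apply: le_measure; rewrite ?inE.
  rewrite lebesgueN_borel; last exact: measurable_cube.
  by rewrite borel_lebesgue_cube ?ltry// mulr_ge0// ltW.
have muU_gt0 : (0 < @lebesgueN R N U)%E.
  apply: (@lt_le_trans _ _ (@lebesgueN R N (cube a rho : set (eucl R N)))).
    rewrite lebesgueN_borel; last exact: measurable_cube.
    by rewrite borel_lebesgue_cube ?(ltW rho0)// lte_fin exprn_gt0// mulr_gt0.
  by apply: le_measure; rewrite ?inE.
pose V := fine (@lebesgueN R N U).
have muU : @lebesgueN R N U = V%:E by rewrite fineK// ge0_fin_numE.
have V0 : 0 < V by rewrite fine_gt0// muU_gt0.
pose J := (\int[@lebesgueN R N]_(x in U) (u x * u x)%:E)%E.
have J0 : (0 <= J)%E.
  by apply: integral_ge0 => x _; rewrite lee_fin -expr2 sqr_ge0.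
have Jfin : (J < +oo)%E.
  have [M fM] := monomial_sum_bounded s a (N%:R * 4 / delta * rho).
  apply: (@le_lt_trans _ _ (\int[@lebesgueN R N]_(x in U) (M ^+ 2)%:E)%E).
    apply: ge0_le_integral => //.
    - by move=> x _; rewrite lee_fin -expr2 sqr_ge0.
    - by apply/measurable_EFinP; exact: measurable_funM.
    - move=> x Ux; have fxM := fM x (Ua _ Ux).
      rewrite lee_fin uE ?inE// -expr2 -real_normK ?num_real//.
      by rewrite lerXn2r ?nnegrE// (le_trans _ fxM).
  by rewrite integral_cst// [X in (_ * X)%E]muU -EFinM ltry.
pose j := fine J.
have jE : J = j%:E by rewrite fineK// ge0_fin_numE.
have j0 : 0 <= j by rewrite fine_ge0.
(* The inverse estimate reads u(x)^2 * V <= C * j on U, so S bounds |u| there. *)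
pose S := Num.sqrt (C * j / V).
have SV : S ^+ 2 * V = C * j.
  by rewrite sqr_sqrtr ?divfK ?gt_eqF// divr_ge0 ?mulr_ge0// ltW.
have uS x : U x -> `|u x| <= S.
  move=> Ux; rewrite -sqrtr_sqr ler_wsqrtr// ler_pdivlMr// -lee_fin EFinM -muU.
  rewrite uE ?inE//; apply: (le_trans (HC s _ _ _ mU rho0 aU Ua _ Ux)).
  rewrite EFinM -jE /J lee_wpmul2l ?lee_fin// le_eqVlt; apply/orP; left;
    apply/eqP.
  by apply: eq_integral => y yU; rewrite uE// expr2.
have S0 : 0 <= S by exact: sqrtr_ge0.
apply: (Lnorm_le_of_bounded_by_Lnorm1 (S := S) mU muU V0 p_ge1) => //.
- exact/(measurable_restrictT _ _).1.
- exact/(measurable_restrictT _ _).1.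
- by move=> x xU; rewrite patchE memNset.
- by move=> x xU; rewrite patchE memNset.
- by move=> x; rewrite patchE; case: ifPn; rewrite ?normr0// inE => /uS.
(* It remains to prove S * V <= C * |g|_1. For S > 0 both sides are multiplied by S: then S^2 * V =
   C * j, and j, the integral of g * u, is at most S * |g|_1. *)
have [S00|Sn0] := eqVneq S 0.
  by rewrite S00 mul0r mule_ge0// Lnorm_ge0.
have Sgt0 : 0 < S by rewrite lt_neqAle eq_sym Sn0.
rewrite -(@lee_pmul2l _ S%:E)// ?lte_fin//.
rewrite -EFinM mulrA -expr2 SV EFinM -jE muleCA lee_wpmul2l ?lee_fin//.
rewrite Lnorm1 /J uP; last by exists q.
apply: (le_trans (lee_abs _)).
have mgu : measurable_fun U (fun x => (g x * u x)%:E).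
  by apply/measurable_EFinP; exact: measurable_funM.
apply: (le_trans (le_abse_integral _ mU mgu)).
have mag : measurable_fun U (fun x => `|g x|%:E).
  by apply/measurable_EFinP; exact: measurableT_comp.
apply: (@le_trans _ _ (\int[@lebesgueN R N]_(x in U) (S%:E * `|g x|%:E))%E).
  apply: ge0_le_integral => //.
  - exact: measurableT_comp.
  - exact: measurable_funeM.
  - move=> x Ux; rewrite -EFinM lee_fin normrM mulrC ler_wpM2r//.
    exact: uS.
rewrite ge0_integralZl// lee_wpmul2l// integral_mkcond le_eqVlt; apply/orP;
  left.
apply/eqP/eq_integral => x _; rewrite /= !patchE; case: ifP => //.
by rewrite normr0.
Qed.
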